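(* For a chainmail morphism $m\colon \Gamma_1\to\Gamma_2$ define $\mathcal{D}(m)\colon \mathcal{D}(\Gamma_1)\to\mathcal{D}(\Gamma_2)$ by \[\mathcal{D}(m)(D_1)=\bigvee\{\{m(d)\}\mid d\in D_1\}\quad\text{(join in } \mathcal{D}(\Gamma_2)).\] Then $\Gamma\mapsto\mathcal{D}(\Gamma)$, $m\mapsto\mathcal{D}(m)$ defines a functor $\mathcal{D}\colon\mathbf{Chm}\to\mathbf{Con}$. The right adjoint $\mathcal{D}(m)^\bullet$ of the monotone map $\mathcal{D}(m)$ sends a totally disconnected set $D_2\in\mathcal{D}(\Gamma_2)$ to \[\mathcal{D}(m)^\bullet(D_2)=\left(m^{-1}(D_2^\downarrow)\right)^\ast.\] The functor $\mathcal{D}$ has a right adjoint functor $\mathcal{K}\colon\mathbf{Con}\to\mathbf{Chm}$, sending a complete lattice $L$ to $\mathcal{K}(L)$ and a connectivity homomorphism $F\colon L_1\to L_2$ to the function $\mathcal{K}(F)\colon\mathcal{K}(L_1)\to\mathcal{K}(L_2)$ that maps a connected element $c$ of $L_1$ to $F(c)$. The unit $\eta$ of this adjunction is a natural isomorphism, given for each chainmail $\Gamma$ by $\eta_\Gamma\colon\Gamma\to\mathcal{K}\mathcal{D}(\Gamma)$, $\eta_\Gamma(x)=\{x\}$. The counit $\varepsilon$ of this adjunction is given for each complete lattice $L$ by $\varepsilon_L\colon\mathcal{D}\mathcal{K}(L)\to L$, $\varepsilon_L(D)=\bigvee D$ (join in $L$), and each $\varepsilon_L$ is a monomorphism (in 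$\mathbf{Con}$).
   Context: Chainmails. In a poset, a mail is a non-empty set of elements having a common lower bound in the poset. A chainmail is a poset in which every mail has a join. A subset $C$ of a poset is mail-connected if it is non-empty and for any $c,d\in C$ there is a sequence $c=x_0,x_1,\dots,x_n=d$ in $C$ such that $x_{i-1},x_i$ have a common lower bound in the poset (not necessarily in $C$) for each $i\in\{1,\dots,n\}$. In a chainmail every mail-connected set has a join. A chainmail morphism $m\colon\Gamma_1\to\Gamma_2$ is a map between chainmails preserving joins of mails: for every mail $M$ in $\Gamma_1$, $m(\bigvee M)$ is the join of $m(M)$ in $\Gamma_2$. $\mathbf{Chm}$ is the category of chainmails and chainmail morphisms. Complete lattices. In a complete lattice $L$ with bottom $0$, a separated set is a subset $S\subseteq L$ with $0\notin S$ and $s\wedge s'=0$ for any two distinct $s,s'\in S$. An element $a\in L$ is connected if for every separated set $S$, $a\le\bigvee S$ implies $a\le s$ for some $s\in S$. $\mathcal{K}(L)$ is the poset of connected elements of $L$ with the order induced from $L$; it is a chainmail. A connectivity homomorphism $F\colon L\to M$ between complete lattices is a map preserving all joins whose right adjoint $F^\bullet\colon M\to L$ (in the sense of monotone Galois connections: $F(x)\le y\iff x\le F^\bullet(y)$) preserves joins of separated sets. $\mathbf{Con}$ is the category of complete lattices and connectivity homomorphisms. The construction $\mathcal{D}$. A set of elements of a poset is totally disconnected if no two distinct elements of it have a common lower bound in the poset. For a chainmail $\Gamma$, $\mathcal{D}(\Gamma)$ is the poset of totally disconnected subsets of $\Gamma$ (including the empty set), with $D_1\le D_2$ iff each element of $D_1$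 is below some element of $D_2$; it is a complete lattice. For a subset $D$ of $\Gamma$, $D^\downarrow$ is the set of elements of $\Gamma$ that are below some element of $D$. For a down-closed subset $X$ of $\Gamma$ that is closed under joins of mails contained in $X$, $X^\ast$ denotes the set of joins of the maximal mail-connected subsets of $X$; it is a totally disconnected set with $(X^\ast)^\downarrow=X$. *)

(* Defs.v *)
From HB Require Import structures.
From mathcomp Require Import all_boot all_order.
From mathcomp Require Import boolp classical_sets.

Set Implicit Arguments.
Unset Strict Implicit.
Unset Printing Implicit Defensive.

Import Order.Theory.
Local Open Scope classical_set_scope.
Local Open Scope order_scope.

(* Posets are [porderType]s, and "x is the join of A" is [supremums A x].
   An order display [d] only drives notations, so nothing is lost by letting
   all the objects of a category share the same one. *)

Record category := Category {
  obj :> Type;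
  hom : obj -> obj -> Type;
  idm : forall a, hom a a;
  compm : forall a b c, hom b c -> hom a b -> hom a c;
  comp1m : forall a b (f : hom a b), compm (idm b) f = f;
  compm1 : forall a b (f : hom a b), compm f (idm a) = f;
  compmA : forall a b c e (h : hom c e) (g : hom b c) (f : hom a b),
    compm h (compm g f) = compm (compm h g) f }.

Arguments hom {_} _ _.
Arguments idm {_} _.
Arguments compm {_ _ _ _} _ _.

(* [functor F0] is the type of functors with object map [F0]; indexing by the
   object map lets one prescribe it without transporting along equalities. *)
Record functor (C D : category) (F0 : C -> D) := Functor {
  fmor :> forall a b, hom a b -> hom (F0 a) (F0 b);
  fmor_id : forall a, fmor (idm a) = idm (F0 a);
  fmor_comp : forall a b c (g : hom b c) (f : hom a b),
    fmor (compm g f) = compm (fmor g) (fmor f) }.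

Arguments fmor {C D F0} _ {a b} _.

Definition idF (C : category) : functor (fun a : C => a) :=
  @Functor C C (fun a => a) (fun _ _ f => f)
    (fun _ => erefl) (fun _ _ _ _ _ => erefl).

Section CompF.
Variables (C D E : category) (F0 : C -> D) (G0 : D -> E).
Variables (G : functor G0) (F : functor F0).

Let compF_mor (a b : C) (f : hom a b) : hom (G0 (F0 a)) (G0 (F0 b)) :=
  fmor G (fmor F f).

Lemma compF_id a : compF_mor (idm a) = idm (G0 (F0 a)).
Proof. by rewrite /compF_mor !fmor_id. Qed.

Lemma compF_comp a b c (g : hom b c) (f : hom a b) :
  compF_mor (compm g f) = compm (compF_mor g) (compF_mor f).
Proof. by rewrite /compF_mor !fmor_comp. Qed.

Definition compF : functor (fun a => G0 (F0 a)) :=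
  @Functor C E (fun a => G0 (F0 a)) compF_mor compF_id compF_comp.

End CompF.

Record nat_trans (C D : category) (F0 G0 : C -> D)
    (F : functor F0) (G : functor G0) := NatTrans {
  component :> forall a, hom (F0 a) (G0 a);
  naturality : forall a b (f : hom a b),
    compm (component b) (fmor F f) = compm (fmor G f) (component a) }.

Section CategoryPredicates.
Variable C : category.

Definition is_iso (a b : C) (f : hom a b) :=
  exists2 g : hom b a, compm g f = idm a & compm f g = idm b.

Definition is_mono (a b : C) (f : hom a b) :=
  forall (c : C) (g h : hom c a), compm f g = compm f h -> g = h.

End CategoryPredicates.

Definition is_nat_iso (C D : category) (F0 G0 : C -> D)
    (F : functor F0) (G : functor G0) (t : nat_trans F G) :=
  forall a, is_iso (t a).

(* [F] is left adjoint to [G] with unit [eta] and counit [eps]. *)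
Definition is_adjunction (C D : category) (F0 : C -> D) (G0 : D -> C)
    (F : functor F0) (G : functor G0)
    (eta : nat_trans (idF C) (compF G F)) (eps : nat_trans (compF F G) (idF D)) :=
  (forall a : C, compm (eps (F0 a)) (fmor F (eta a)) = idm (F0 a)) /\
  (forall b : D, compm (fmor G (eps b)) (eta (G0 b)) = idm (G0 b)).

Section PosetNotions.
Context {d : Order.disp_t} {T : porderType d}.
Implicit Types (x y z : T) (A C M X D : set T).

Definition has_lb x y := exists2 z, z <= x & z <= y.

Definition mail M := M !=set0 /\ lbound M !=set0.

Definition linked_in C x y := exists (n : nat) (p : nat -> T),
  [/\ p 0%N = x, p n = y, forall i, (i <= n)%N -> C (p i) &
      forall i, (i < n)%N -> has_lb (p i) (p i.+1)].

Definition mail_connected C :=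
  C !=set0 /\ forall x y, C x -> C y -> linked_in C x y.

Definition max_mail_connected X C :=
  [/\ C `<=` X, mail_connected C &
      forall C', C' `<=` X -> mail_connected C' -> C `<=` C' -> C' `<=` C].

(* [star X] is only meaningful when [X] is down-closed and closed under the
   joins of the mails it contains. *)
Definition star X : set T :=
  [set x | exists2 C, max_mail_connected X C & supremums C x].

Definition down_closed X := forall x y, X y -> x <= y -> X x.

Definition mail_join_closed X :=
  forall M x, mail M -> M `<=` X -> supremums M x -> X x.

Definition totally_disconnected D :=
  forall x y, D x -> D y -> has_lb x y -> x = y.

Lemma has_lb_refl x : has_lb x x. Proof. by exists x. Qed.

Lemma has_lb_sym x y : has_lb x y -> has_lb y x.
Proof. by case=> z zx zy; exists z. Qed.

Lemma linked_in_refl C x : C x -> linked_in C x x.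
Proof. by move=> Cx; exists 0%N, (fun=> x); split. Qed.

Lemma linked_in_cons C x y z : C x -> has_lb x y -> linked_in C y z ->
  linked_in C x z.
Proof.
move=> Cx xy [n [p [p0 pn Cp lp]]].
exists n.+1, (fun i => if i is j.+1 then p j else x); split=> //.
- by case=> // i /Cp.
- by case=> [_|i /lp //]; rewrite p0.
Qed.

Lemma linked_in_ind C (P : T -> Prop) x y : P x ->
  (forall u v, C u -> C v -> has_lb u v -> P u -> P v) ->
  linked_in C x y -> P y.
Proof.
move=> Px IH [n [p [p0 <- Cp lp]]].
elim: n Cp lp => [|n IHn] Cp lp; first by rewrite p0.
apply: (IH (p n)); [by apply: Cp|by apply: Cp|by apply: lp|].
by apply: IHn => i lin; [apply: Cp; rewrite leqW|apply: lp; rewrite ltnW].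
Qed.

Lemma linked_in_sub C C' x y : C `<=` C' -> linked_in C x y -> linked_in C' x y.
Proof.
move=> CC' [n [p [p0 pn Cp lp]]]; exists n, p; split=> // i /Cp; exact: CC'.
Qed.

Lemma linked_in_sym C x y : C x -> linked_in C x y -> linked_in C y x.
Proof.
move=> Cx; apply: (@linked_in_ind C (fun u => linked_in C u x) x y).
  exact: linked_in_refl.
by move=> u v Cu Cv uv; apply: linked_in_cons Cv (has_lb_sym uv).
Qed.

Lemma linked_in_trans C x y z : C x -> C y ->
  linked_in C x y -> linked_in C y z -> linked_in C x z.
Proof.
move=> Cx Cy xy yz; have yx := linked_in_sym Cx xy.
apply: (@linked_in_ind C (fun u => linked_in C u z) y x yz _ yx).
by move=> u v Cu Cv uv; apply: linked_in_cons Cv (has_lb_sym uv).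
Qed.

Lemma linked_in_snoc C x y z : C x -> C y -> C z -> has_lb y z ->
  linked_in C x y -> linked_in C x z.
Proof.
move=> Cx Cy Cz yz xy; apply: linked_in_trans xy _ => //.
exact: linked_in_cons Cy yz (linked_in_refl Cz).
Qed.

Lemma linked_in_component X x y : X x ->
  linked_in X x y -> linked_in (linked_in X x) x y.
Proof.
move=> Xx xy.
suff [] : linked_in X x y /\ linked_in (linked_in X x) x y by [].
apply: (@linked_in_ind X (fun y =>
  linked_in X x y /\ linked_in (linked_in X x) x y) x y _ _ xy) => [|u v Xu Xv uv].
  by have xx := linked_in_refl Xx; split=> //; exact: linked_in_refl.
move=> [xu xxu]; have xv := linked_in_snoc Xx Xu Xv uv xu.
by split=> //; apply: linked_in_snoc uv xxu => //; exact: linked_in_refl.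
Qed.

Lemma component_max X x : X x -> max_mail_connected X (linked_in X x).
Proof.
move=> Xx; have cx : linked_in X x x by exact: linked_in_refl.
split.
- by move=> y; apply: (@linked_in_ind X X x y).
- split; first by exists x.
  move=> y z xy xz; apply: (linked_in_trans (y := x)) => //.
    by apply: linked_in_sym => //; exact: linked_in_component.
  exact: linked_in_component.
- move=> C' C'X [_ conn] sub y C'y; apply: linked_in_sub C'X _.
  by apply: conn => //; exact: sub.
Qed.

Lemma max_mail_connected_eq X C x : C x ->
  max_mail_connected X C -> C = linked_in X x.
Proof.
move=> Cx [CX Cconn Cmax]; have [cX cconn _] := component_max (CX _ Cx).
have sub : C `<=` linked_in X x.
  by move=> y Cy; apply: linked_in_sub CX _; exact: Cconn.2.
by apply/seteqP; split=> //; exact: Cmax.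
Qed.

Lemma supremums_uniq A x y : supremums A x -> supremums A y -> x = y.
Proof. exact: is_subset1_supremums. Qed.

Lemma supremums2 x y : x <= y -> supremums [set x; y] y.
Proof.
by move=> xy; split=> [_ [->|->]//|u]; apply; right.
Qed.

Lemma down_down_closed D : down_closed (down D).
Proof. by move=> x y [z [Dz yz]] xy; exists z; split=> //; exact: le_trans yz. Qed.

Lemma down_mail_join_closed D : totally_disconnected D ->
  mail_join_closed (down D).
Proof.
move=> tdD M x [[m Mm] [l lM]] MD [_ lubx].
have [y [Dy my]] := MD _ Mm; exists y; split=> //; apply: lubx => m' Mm'.
have [y' [Dy' my']] := MD _ Mm'; suff -> : y = y' by [].
apply: tdD => //; exists l.
  by apply: le_trans my; exact: lM.
by apply: le_trans my'; exact: lM.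
Qed.

End PosetNotions.

HB.mixin Record POrder_isChainmail d (T : Type) of Order.POrder d T := {
  mail_has_join : forall M : set T, mail M -> exists x, supremums M x }.

#[short(type="chainmailType")]
HB.structure Definition Chainmail d :=
  { T of POrder_isChainmail d T & Order.POrder d T }.

Section ChainmailTheory.
Context {d : Order.disp_t} {G : chainmailType d}.
Implicit Types (x y z : G) (C X : set G).

Inductive partial_join C x : G -> Prop :=
| PJ_base : partial_join C x x
| PJ_step j c k : partial_join C x j -> C c -> has_lb j c ->
    supremums [set j; c] k -> partial_join C x k.

Lemma partial_join_ge C x j : partial_join C x j -> x <= j.
Proof.
elim=> {j} // j c k _ xj _ _ [ub _]; apply: le_trans xj _; apply: ub; by left.
Qed.

Lemma partial_join_mail C x : mail (partial_join C x).
Proof.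
by split; exists x; [exact: PJ_base|move=> j; exact: partial_join_ge].
Qed.

Lemma mail2 x y : has_lb x y -> mail [set x; y].
Proof.
by move=> [l lx ly]; split; [exists x; left|exists l => _ [->|->]].
Qed.

Lemma partial_join_above C x y : C x -> linked_in C x y ->
  exists2 j, partial_join C x j & y <= j.
Proof.
move=> Cx; apply: (@linked_in_ind _ _ C
  (fun u => exists2 j, partial_join C x j & u <= j) x y) => [|u v Cu Cv [l lu lv] [j pj uj]].
  by exists x => //; exact: PJ_base.
have jv : has_lb j v by exists l => //; exact: le_trans uj.
have [k supk] := mail_has_join _ (mail2 jv).
by exists k; [exact: PJ_step supk|apply: supk.1; right].
Qed.

Lemma mail_connected_join_in C x : mail_connected C -> C x ->
  exists2 s, supremums C s & supremums (partial_join C x) s.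
Proof.
move=> [_ Cc] Cx; have [s [ubs lubs]] := mail_has_join _ (partial_join_mail C x).
exists s => //; split=> [y Cy|u ubu].
  have [j pj yj] := partial_join_above Cx (Cc _ _ Cx Cy).
  by apply: le_trans yj _; exact: ubs.
apply: lubs => j; elim=> [|{}j c k _ ju Cc' _ [_ lubk]]; first exact: ubu.
by apply: lubk => _ [->|->] //; exact: ubu.
Qed.

Lemma mail_connected_has_join C : mail_connected C -> exists x, supremums C x.
Proof.
move=> Cc; have [[x Cx] _] := Cc.
by have [s ss _] := mail_connected_join_in Cc Cx; exists s.
Qed.

Lemma mail_connected_join_closed X C s : mail_join_closed X ->
  C `<=` X -> mail_connected C -> supremums C s -> X s.
Proof.
move=> mX CX Cc ss; have [[x Cx] _] := Cc.
have [s' ss' ps] := mail_connected_join_in Cc Cx.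
rewrite (supremums_uniq ss ss'); apply: (mX _ _ (partial_join_mail C x) _ ps) => j.
elim=> [|{}j c k _ Xj Cc' jc supk]; first exact: CX.
by apply: (mX _ _ (mail2 jc) _ supk) => _ [->|->] //; exact: CX.
Qed.

Section Star.
Variable X : set G.
Hypotheses (dX : down_closed X) (mX : mail_join_closed X).

Lemma star_sub : star X `<=` X.
Proof.
by move=> s [C [CX Cc _]]; exact: mail_connected_join_closed.
Qed.

Lemma star_component s C : max_mail_connected X C -> supremums C s ->
  C = linked_in X s.
Proof.
move=> Cmax ss; have [CX [[x Cx] _] _] := Cmax.
have Xs : X s by apply: star_sub; exists C.
rewrite (max_mail_connected_eq Cx Cmax).
have xs : linked_in X x s.
  apply: linked_in_cons (linked_in_refl Xs); first exact: CX.
  by exists x => //; exact: ss.1.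
have sx := linked_in_sym (CX _ Cx) xs.
by apply/seteqP; split=> y; apply: linked_in_trans => //; exact: CX.
Qed.

Lemma star_totally_disconnected : totally_disconnected (star X).
Proof.
move=> s s' Ss Ss' lb; have [Xs Xs'] := (star_sub Ss, star_sub Ss').
case: Ss Ss' => [C Cmax ss] [C' Cmax' ss'].
suff CC' : C = C' by rewrite CC' in ss; exact: supremums_uniq ss'.
rewrite (star_component Cmax ss) (star_component Cmax' ss').
have l : linked_in X s s' by apply: linked_in_cons lb (linked_in_refl _).
have l' := linked_in_sym Xs l.
by apply/seteqP; split=> y; exact: linked_in_trans.
Qed.

Lemma down_star : down (star X) = X.
Proof.
apply/seteqP; split=> x.
  by move=> [y [/star_sub Xy xy]]; exact: dX xy.
move=> Xx; have cmax := component_max Xx.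
have [s ss] : exists s, supremums (linked_in X x) s.
  by case: cmax => _ cc _; exact: mail_connected_has_join.
exists s; split; first by exists (linked_in X x).
by apply: ss.1; exact: linked_in_refl.
Qed.

End Star.
End ChainmailTheory.

HB.mixin Record TBLattice_isComplete d (T : Type) of Order.TBLattice d T := {
  cjoin : set T -> T;
  cjoinP : forall A : set T, supremums A (cjoin A) }.

#[short(type="completeLatticeType")]
HB.structure Definition CompleteLattice d :=
  { T of TBLattice_isComplete d T & Order.TBLattice d T }.

HB.factory Record POrder_isComplete d (T : Type) of Order.POrder d T := {
  all_have_join : forall A : set T, exists x, supremums A x }.

HB.builders Context d (T : Type) of POrder_isComplete d T.

Let sup (A : set T) : T := projT1 (cid (all_have_join A)).

Let supP (A : set T) : supremums A (sup A).
Proof. exact: projT2 (cid (all_have_join A)). Qed.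

Let meet x y := sup (lbound [set x; y]).
Let join x y := sup [set x; y].
Let bot := sup set0.
Let top := sup setT.

Let meetE x y z : (x <= meet y z) = (x <= y) && (x <= z).
Proof.
have [ub lub] := supP (lbound [set y; z]).
apply/idP/andP => [xm|[xy xz]]; last by apply: ub => _ [->|->].
by split; apply: le_trans xm _; apply: lub => l; apply; [left|right].
Qed.

Let joinE x y z : (join x y <= z) = (x <= z) && (y <= z).
Proof.
have [ub lub] := supP [set x; y].
apply/idP/andP => [jz|[xz yz]]; last by apply: lub => _ [->|->].
by split; apply: le_trans jz; apply: ub; [left|right].
Qed.

Let botE x : bot <= x. Proof. exact: (supP set0).2. Qed.
Let topE x : x <= top. Proof. exact: (supP setT).1. Qed.

HB.instance Definition _ := Order.POrder_MeetJoin_isLattice.Build d T meetE joinE.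
HB.instance Definition _ := Order.hasBottom.Build d T botE.
HB.instance Definition _ := Order.hasTop.Build d T topE.
HB.instance Definition _ := TBLattice_isComplete.Build d T supP.

HB.end.

Section CompleteLatticeNotions.
Context {d : Order.disp_t} {L : completeLatticeType d}.
Implicit Types (a x y : L) (S : set L).

Definition separated S :=
  ~ S \bot /\ forall x y, S x -> S y -> x <> y -> x `&` y = \bot.

Definition connected a :=
  forall S, separated S -> a <= cjoin S -> exists2 s, S s & a <= s.

Lemma cjoin_ub S x : S x -> x <= cjoin S.
Proof. exact: (cjoinP S).1. Qed.

Lemma cjoin_le S x : (forall y, S y -> y <= x) -> cjoin S <= x.
Proof. exact: (cjoinP S).2. Qed.

Lemma cjoin_unique S x : supremums S x -> cjoin S = x.
Proof. exact/supremums_uniq/cjoinP. Qed.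

Lemma connected_neq0 a : connected a -> a <> \bot.
Proof.
move=> ca a0; have sep0 : separated (set0 : set L) by split.
by have [|s []] := ca _ sep0; rewrite a0 le0x.
Qed.

End CompleteLatticeNotions.

Section TotallyDisconnected.
Context {d : Order.disp_t} (G : chainmailType d).

Record tdset := TDSet {
  td_set :> set G;
  td_setP : `[< totally_disconnected td_set >] }.

HB.instance Definition _ := [isSub for td_set].
HB.instance Definition _ := [Choice of tdset by <:].

Implicit Types (D E : tdset).

Lemma tdsetP D : totally_disconnected D. Proof. exact/asboolP/td_setP. Qed.

Definition td_le D E : bool := `[< forall x, td_set D x -> exists2 y, td_set E y & x <= y >].

Lemma td_le_refl : reflexive td_le.
Proof. by move=> D; apply/asboolP => x Dx; exists x. Qed.

Lemma td_le_trans : transitive td_le.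
Proof.
move=> E D F /asboolP DE /asboolP EF; apply/asboolP => x /DE[y /EF[z Fz yz] xy].
by exists z => //; exact: le_trans yz.
Qed.

Lemma td_le_anti : antisymmetric td_le.
Proof.
suff sub D E : td_le D E -> td_le E D -> td_set D `<=` E.
  by move=> D E /andP[DE ED]; apply/val_inj/seteqP; split; exact: sub.
move=> /asboolP DE /asboolP ED x Dx; have [y Ey xy] := DE _ Dx.
have [z Dz yz] := ED _ Ey; suff <- : y = x by [].
apply/le_anti; rewrite xy andbT (_ : x = z) //.
by apply: (tdsetP Dx Dz); exists x => //; exact: le_trans yz.
Qed.

HB.instance Definition _ :=
  Order.Le_isPOrder.Build d tdset td_le_refl td_le_anti td_le_trans.

Lemma tdleP D E : reflect (forall x, td_set D x -> exists2 y, td_set E y & x <= y)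
    (D <= E).
Proof. exact: asboolP. Qed.

Lemma tdle_down D E : (D <= E) <-> (down D `<=` down E).
Proof.
split=> [/tdleP DE x [y [/DE[z Ez yz] xy]]|DE].
  by exists z; split=> //; exact: le_trans yz.
by apply/tdleP => x Dx; apply/downP/DE; exists x.
Qed.

Lemma tdset_has_join (A : set tdset) : exists D, supremums A D.
Proof.
pose X := [set x | forall E : tdset, ubound A E -> down E x].
have dX : down_closed X.
  by move=> x y Xy xy E /Xy; move/down_down_closed; apply.
have mX : mail_join_closed X.
  move=> M x mM MX sx E uE; apply: down_mail_join_closed mM _ sx.
    exact: tdsetP.
  by move=> y /MX; apply.
exists (TDSet (asboolT (star_totally_disconnected mX))); split=> [D AD|E uE].
  apply/tdle_down; rewrite /= down_star // => x Dx E /(_ _ AD) /tdle_down; exact.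
by apply/tdle_down; rewrite /= down_star // => x; apply.
Qed.

HB.instance Definition _ := POrder_isComplete.Build d tdset tdset_has_join.

Lemma td1_subproof (x : G) : `[< totally_disconnected [set x] >].
Proof. by apply/asboolP => _ _ -> ->. Qed.

Definition td1 (x : G) : tdset := TDSet (td1_subproof x).

End TotallyDisconnected.

Arguments td1 {d G} x.

Section ConnectedElements.
Context {d : Order.disp_t} (L : completeLatticeType d).

Record conn_elt := ConnElt {
  conn_val :> L;
  conn_valP : `[< connected conn_val >] }.

HB.instance Definition _ := [isSub for conn_val].
HB.instance Definition _ := [Choice of conn_elt by <:].
HB.instance Definition _ := [SubChoice_isSubPOrder of conn_elt by <: with d].

Lemma conn_eltP (a : conn_elt) : connected (a : L).
Proof. exact/asboolP/conn_valP. Qed.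

Lemma conn_elt_mail_join (M : set conn_elt) : mail M ->
  exists x, supremums M x.
Proof.
move=> [[m Mm] [l lM]]; pose S : set L := [set conn_val a | a in M].
have cS : connected (cjoin S).
  move=> U sepU leU.
  have ex a : M a -> exists2 u, U u & (a : L) <= u.
    move=> Ma; apply: conn_eltP sepU (le_trans _ leU).
    by apply: cjoin_ub; exists a.
  have [u Uu mu] := ex _ Mm; exists u => //; apply: cjoin_le => _ [a Ma <-].
  have [v Uv av] := ex _ Ma.
  have [<- //|/eqP uv] := eqVneq v u.
  case: (connected_neq0 (@conn_eltP l)); apply/eqP; rewrite -lex0.
  rewrite -(sepU.2 _ _ Uv Uu uv) lexI.
  by rewrite (le_trans _ av) ?(le_trans _ mu) //; exact: lM.
exists (ConnElt (asboolT cS)); split=> [a Ma|b ub].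
  by apply: cjoin_ub; exists a.
by apply: cjoin_le => _ [a Ma <-]; exact: ub.
Qed.

HB.instance Definition _ :=
  POrder_isChainmail.Build d conn_elt conn_elt_mail_join.

End ConnectedElements.

Record chmor d (G H : chainmailType d) := ChMor {
  chmor_fun :> G -> H;
  chmor_join : forall M x, mail M -> supremums M x ->
    supremums [set chmor_fun y | y in M] (chmor_fun x) }.

Definition galois d (L M : porderType d) (F : L -> M) (G : M -> L) :=
  forall x y, (F x <= y) = (x <= G y).

Definition preserves_joins d (L M : completeLatticeType d) (F : L -> M) :=
  forall A : set L, F (cjoin A) = cjoin [set F x | x in A].

Definition preserves_separated_joins d (L M : completeLatticeType d)
    (F : L -> M) :=
  forall S : set L, separated S -> F (cjoin S) = cjoin [set F x | x in S].

Record conhom d (L M : completeLatticeType d) := ConHom {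
  conhom_fun :> L -> M;
  conhom_join : preserves_joins conhom_fun;
  conhom_adj : exists2 G : M -> L,
    galois conhom_fun G & preserves_separated_joins G }.

Section ChainmailCategory.
Variable d : Order.disp_t.
Implicit Types G H K : chainmailType d.

Lemma chmor_ext G H (f g : chmor G H) : f =1 g -> f = g.
Proof.
case: f g => [f fP] [g gP] /= /funext fg; case: _ / fg in gP *.
by congr ChMor; exact: Prop_irrelevance.
Qed.

Lemma chmor_mono G H (f : chmor G H) x y : x <= y -> f x <= f y.
Proof.
move=> xy; have lb : has_lb x y by exists x.
apply: (chmor_join f (mail2 lb) (supremums2 xy)).1.
by exists x => //; left.
Qed.

Lemma chmor_mail G H (f : chmor G H) (M : set G) :
  mail M -> mail [set f x | x in M].
Proof.
move=> [[x Mx] [l lM]]; split; first by exists (f x), x.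
by exists (f l) => _ [y My <-]; apply: chmor_mono; exact: lM.
Qed.

Definition chmor_id G : chmor G G.
Proof. by exists id => M x mM sx; rewrite image_id. Defined.

Definition chmor_comp G H K (g : chmor H K) (f : chmor G H) : chmor G K.
Proof.
exists (g \o f) => M x mM sx.
rewrite -(image_comp f g); apply: chmor_join; first exact: chmor_mail.
exact: chmor_join.
Defined.

Definition Chm : category.
Proof.
by apply: (@Category (chainmailType d) (@chmor d) chmor_id chmor_comp) => *;
  exact: chmor_ext.
Defined.

End ChainmailCategory.

Section CompleteLatticeCategory.
Variable d : Order.disp_t.
Implicit Types L M N : completeLatticeType d.

Lemma conhom_ext L M (f g : conhom L M) : f =1 g -> f = g.
Proof.
case: f g => [f fP fA] [g gP gA] /= /funext fg; case: _ / fg in gP gA *.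
by congr ConHom; exact: Prop_irrelevance.
Qed.

Lemma cjoin0 L : cjoin (set0 : set L) = \bot.
Proof. by apply/eqP; rewrite -lex0; apply: cjoin_le. Qed.

Lemma cjoinD0 L (A : set L) : cjoin (A `\` [set \bot]) = cjoin A.
Proof.
apply/le_anti/andP; split; apply: cjoin_le => x.
  by move=> [Ax _]; exact: cjoin_ub.
have [-> _|x0 Ax] := eqVneq x \bot; first exact: le0x.
by apply: cjoin_ub; split=> //; exact/eqP.
Qed.

Lemma preserves_separated_joins0 L M (F : L -> M) :
  preserves_separated_joins F -> F \bot = \bot.
Proof.
move=> sF; have sep0 : separated (set0 : set L) by split.
by rewrite -(cjoin0 L) sF // image_set0 cjoin0.
Qed.

Lemma galois_meet L M (F : L -> M) (G : M -> L) : galois F G ->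
  forall x y, G (x `&` y) = G x `&` G y.
Proof.
move=> FG x y; have le z : (z <= G (x `&` y)) = (z <= G x `&` G y).
  by rewrite lexI -!FG lexI.
by apply/le_anti; rewrite -le lexx le lexx.
Qed.

Definition conhom_id L : conhom L L.
Proof.
exists id; first by move=> A; rewrite image_id.
by exists id => // S _; rewrite image_id.
Defined.

Lemma conhom_comp_adj L M N (g : conhom M N) (f : conhom L M) :
  exists2 G : N -> L, galois (g \o f) G & preserves_separated_joins G.
Proof.
have [[Gf adjf sepf] [Gg adjg sepg]] := (conhom_adj f, conhom_adj g).
exists (Gf \o Gg) => [x y|S sepS]; first by rewrite /= adjg adjf.
rewrite /= sepg // -(cjoinD0 (Gg @` S)) sepf; last first.
  split=> [[_ /(_ erefl)] //|_ _ [[x Sx <-] _] [[y Sy <-] _] xy].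
  rewrite -(galois_meet adjg) sepS.2 ?(preserves_separated_joins0 sepg) //.
  by move=> exy; apply: xy; rewrite exy.
rewrite -(image_comp Gg Gf) -[RHS]cjoinD0 -[LHS]cjoinD0; congr cjoin.
apply/seteqP; split=> _ [[x Sx <-] x0]; split=> //; exists x => //.
  by case: Sx.
by split=> // xb; apply: x0; rewrite xb /= (preserves_separated_joins0 sepf).
Qed.

Definition conhom_comp L M N (g : conhom M N) (f : conhom L M) : conhom L N.
Proof.
exists (g \o f); last exact: conhom_comp_adj.
by move=> A; rewrite -(image_comp f g) /= !conhom_join.
Defined.

Definition Con : category.
Proof.
by apply: (@Category (completeLatticeType d) (@conhom d) conhom_id conhom_comp)
  => *; exact: conhom_ext.
Defined.

End CompleteLatticeCategory.

Definition Dob d (G : Chm d) : Con d := tdset G.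

Definition Kob d (L : Con d) : Chm d := conn_elt L.

(* Main.v *)
Require Import Defs.
From mathcomp Require Import all_boot all_order.
From mathcomp Require Import boolp classical_sets.

(** The adjunction comes down to one universal property: every chainmail
    morphism [f] from [G] to the connected elements of a complete lattice [L]
    extends along [x |-> {x}] to a connectivity homomorphism from
    [tdset G] to [L], namely [D |-> \/ f(D)] ([extension]), and two
    maps out of [tdset G] that preserve separated joins and agree on singletons
    are equal ([eq_on_singletons]).

    A totally disconnected set is determined by its down-set, and the down-sets
    that arise are the down-closed sets closed under joins of mails.  The right
    adjoint of the extension must therefore send [a] to the totally disconnected
    set whose down-set is [{x | f x <= a}], that is, to its star
    ([extend_galois]).  Since each [f x] is connected, [f x] lies below a
    separated join only if it lies below one of the joinands; hence the right
    adjoint preserves separated joins ([extend_radj_separated]).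

    The singletons are exactly the connected elements of [tdset G]: the
    join of a separated family in [tdset G] is its union, which makes singletons
    connected ([td1_connected]), and a totally disconnected set is the separated
    join of its singletons, so that a connected one lies below one of them
    ([connected_td1]).  This is the unit, and it is an isomorphism.  The
    functor on morphisms is the extension of [x |-> {m x}], the counit is the
    extension of the identity of [conn_elt L], and the equations of functoriality,
    naturality and the triangles are all checked on singletons.

    The counit need not be injective, because two connected elements without
    a connected lower bound may still have a non-zero meet.  It is a
    monomorphism because its right adjoint has every singleton [{c}] among its
    values: if [g] and [h] have the same composite with the counit, their right
    adjoints agree on singletons, hence on all separated joins of singletons,
    hence everywhere ([counit_mono]). *)

Set Implicit Arguments.
Unset Strict Implicit.
Unset Printing Implicit Defensive.

Import Order.Theory.
Local Open Scope classical_set_scope.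
Local Open Scope order_scope.

(** * Galois connections and connected elements *)

Section CompleteLattices.
Context {d : Order.disp_t}.
Implicit Types (P Q : porderType d) (L M : completeLatticeType d).

Lemma galois_homo P Q (F : P -> Q) (G : Q -> P) : galois F G ->
  {homo G : x y / x <= y}.
Proof. by move=> FG x y xy; rewrite -FG (le_trans _ xy) ?FG. Qed.

Lemma eq_from_lower P (x y : P) : (forall z, (z <= x) = (z <= y)) -> x = y.
Proof. by move=> e; apply/le_anti; rewrite -e lexx e lexx. Qed.

Lemma eq_from_upper P (x y : P) : (forall z, (x <= z) = (y <= z)) -> x = y.
Proof. by move=> e; apply/le_anti; rewrite e lexx -e lexx. Qed.

Lemma galois_radj_unique P Q (F : P -> Q) (G G' : Q -> P) :
  galois F G -> galois F G' -> G =1 G'.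
Proof. by move=> FG FG' y; apply: eq_from_lower => x; rewrite -FG FG'. Qed.

Lemma galois_ladj_unique P Q (F F' : P -> Q) (G : Q -> P) :
  galois F G -> galois F' G -> F =1 F'.
Proof. by move=> FG F'G x; apply: eq_from_upper => y; rewrite FG F'G. Qed.

Lemma galois_preserves_joins L M (F : L -> M) (G : M -> L) :
  galois F G -> preserves_joins F.
Proof.
move=> FG A; apply/le_anti/andP; split.
  by rewrite FG; apply: cjoin_le => x Ax; rewrite -FG; apply: cjoin_ub; exists x.
apply: cjoin_le => _ [x Ax <-].
by rewrite FG; apply: (le_trans (cjoin_ub Ax)); rewrite -FG.
Qed.

(** The image of [S] under the right adjoint is separated once [\bot] is
    dropped, which changes no join. *)
Lemma conhom_connected L M (F : conhom L M) a : connected a -> connected (F a).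
Proof.
move=> ca S sepS; have [G FG sG] := conhom_adj F.
rewrite FG sG // -cjoinD0 => /ca [].
  split=> [[_ /(_ erefl)] //|_ _ [[x Sx <-] _] [[y Sy <-] _] xy].
  rewrite -(galois_meet FG) sepS.2 ?(preserves_separated_joins0 sG) //.
  by move=> exy; apply: xy; rewrite exy.
by move=> _ [[s Ss <-] _]; rewrite -FG; exists s.
Qed.

(** Members of a separated set that lie above a common non-zero element [l]
    coincide, so all elements of [A] lie below the same one. *)
Lemma connected_cjoin L (A : set L) l : l <> \bot -> lbound A l -> A !=set0 ->
  A `<=` connected -> connected (cjoin A).
Proof.
move=> l0 lA [a Aa] cA S sepS AS.
have ex b : A b -> exists2 s, S s & b <= s.
  by move=> Ab; apply: cA sepS _ => //; apply: le_trans AS; exact: cjoin_ub.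
have [s Ss las] := ex _ Aa; exists s => //; apply: cjoin_le => b Ab.
have [t St bt] := ex _ Ab.
have [<- //|/eqP ts] := eqVneq t s.
case: l0; apply/eqP; rewrite -lex0 -(sepS.2 _ _ St Ss ts) lexI.
by rewrite (le_trans (lA _ Ab) bt) (le_trans (lA _ Aa) las).
Qed.

(** The join of a mail of connected elements is the same in [conn_elt L] as
    in [L], because the join in [L] is itself connected. *)
Lemma conn_val_supremum L (A : set (conn_elt L)) x : mail A -> supremums A x ->
  conn_val x = cjoin [set conn_val a | a in A].
Proof.
move=> [[a Aa] [l lA]] [ubx lubx].
have cA : connected (cjoin [set conn_val a | a in A]).
  apply: (@connected_cjoin _ _ (conn_val l)).
  - exact: connected_neq0 (@conn_eltP _ _ l).
  - by move=> _ [b Ab <-]; exact: lA.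
  - by exists (conn_val a), a.
  - by move=> _ [b Ab <-]; exact: conn_eltP.
apply/le_anti/andP; split; last first.
  by apply: cjoin_le => _ [b Ab <-]; exact: ubx.
apply: (lubx (ConnElt (asboolT cA))) => b Ab.
by apply: cjoin_ub; exists b.
Qed.

End CompleteLattices.

(** * The complete lattice of totally disconnected sets *)

Section TotallyDisconnectedSets.
Context {d : Order.disp_t} {G : chainmailType d}.
Implicit Types (x y : G) (D E : tdset G) (S : set (tdset G)).

Lemma td1_le x D : td1 x <= D <-> down (td_set D) x.
Proof.
split=> [/tdleP /(_ x erefl) [y Dy xy]|[y [Dy xy]]]; first by exists y.
by apply/tdleP => _ ->; exists y.
Qed.

Lemma td1_le_td1 x y : (td1 x <= td1 y) = (x <= y).
Proof.
apply/idP/idP => [/td1_le [_ [-> //]]|xy].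
by apply/td1_le; exists y.
Qed.

Lemma td1_le_mem x D : td_set D x -> td1 x <= D.
Proof. by move=> Dx; apply/td1_le; exists x. Qed.

Lemma td_leP D E : D <= E <-> forall x, td_set D x -> td1 x <= E.
Proof.
split=> [DE x Dx|DE]; first exact: le_trans (td1_le_mem Dx) DE.
by apply/tdleP => x /DE /td1_le [y [Ey xy]]; exists y.
Qed.

Lemma td_cjoin D : cjoin [set td1 x | x in td_set D] = D.
Proof.
apply/le_anti/andP; split.
  by apply: cjoin_le => _ [x Dx <-]; exact: td1_le_mem.
by apply/td_leP => x Dx; apply: cjoin_ub; exists x.
Qed.

Lemma td_set0 x : ~ td_set (\bot : tdset G) x.
Proof.
have td0 : totally_disconnected (set0 : set G) by [].
have /tdleP b0 := le0x (TDSet (asboolT td0)).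
by move=> /b0 [].
Qed.

Lemma td1_neq0 x : td1 x <> \bot.
Proof. by move=> x0; apply: (@td_set0 x); rewrite -x0. Qed.

Lemma separated_down S D E x : separated S -> S D -> S E ->
  td1 x <= D -> td1 x <= E -> D = E.
Proof.
move=> [_ sepS] SD SE xD xE; apply: contrapT => DE.
by apply: (@td1_neq0 x); apply/eqP; rewrite -lex0 -(sepS _ _ SD SE DE) lexI xD.
Qed.

(** Separatedness makes the union of [S] totally disconnected, so the union
    is the join. *)
Lemma td1_connected x : connected (td1 x).
Proof.
move=> S sepS.
have tdU : totally_disconnected (\bigcup_(D in S) td_set D).
  move=> u v [D SD Du] [E SE Ev] [z zu zv].
  have zD : td1 z <= D by apply/td1_le; exists u.
  have zE : td1 z <= E by apply/td1_le; exists v.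
  rewrite -(separated_down sepS SD SE zD zE) in Ev.
  by apply: (tdsetP Du Ev); exists z.
move=> /le_trans /(_ (_ : _ <= TDSet (asboolT tdU))) /=.
case/(_ _)/td1_le.
  by apply: cjoin_le => D SD; apply/tdleP => u Du; exists u => //; exists D.
by move=> u [[D SD Du] xu]; exists D => //; apply/td1_le; exists u.
Qed.

(** A meet of two singletons of [D] contains only common lower bounds of
    their elements, and there are none. *)
Lemma td1_separated D : separated [set td1 x | x in td_set D].
Proof.
split=> [[x _ /td1_neq0] //|_ _ [x Dx <-] [y Dy <-] xy].
apply/eqP; rewrite -lex0; apply/td_leP => z Iz.
have : td1 z <= td1 x `&` td1 y by apply/td1_le; exists z.
rewrite lexI !td1_le_td1 => /andP [zx zy]; case: xy; congr td1.
by apply: (tdsetP Dx Dy); exists z.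
Qed.

Lemma connected_td1 D : connected D -> exists x, D = td1 x.
Proof.
move=> /(_ _ (td1_separated D)) [|_ [x Dx <-] Dlex]; first by rewrite td_cjoin.
by exists x; apply/le_anti; rewrite Dlex td1_le_mem.
Qed.

(** Stated for separated joins so that it applies both to connectivity
    homomorphisms and to their right adjoints. *)
Lemma eq_on_singletons (L : completeLatticeType d) (f g : tdset G -> L) :
  preserves_separated_joins f -> preserves_separated_joins g ->
  (forall x, f (td1 x) = g (td1 x)) -> f =1 g.
Proof.
move=> fJ gJ fg D; have sD := @td1_separated D.
rewrite -(td_cjoin D) fJ // gJ //; congr cjoin.
by apply/seteqP; split=> _ [_ [x Dx <-] <-]; exists (td1 x); rewrite ?fg //; exists x.
Qed.

End TotallyDisconnectedSets.

(** * Extension along singletons *)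

Section Extension.
Context {d : Order.disp_t} {G : chainmailType d} {L : completeLatticeType d}.
Variable f : chmor G (conn_elt L).
Implicit Types (x : G) (D : tdset G) (a : L).

Definition extend D : L := cjoin [set conn_val (f x) | x in td_set D].

Definition below a : set G := [set x | conn_val (f x) <= a].

Lemma below_down_closed a : down_closed (below a).
Proof. by move=> x y ya xy; apply: le_trans ya; exact: (chmor_mono f xy). Qed.

Lemma below_mail_join_closed a : mail_join_closed (below a).
Proof.
move=> M x mM Ma sx.
rewrite /below /= (conn_val_supremum (chmor_mail f mM) (chmor_join f mM sx)).
by apply: cjoin_le => _ [_ [y My <-] <-]; exact: Ma.
Qed.

Definition extend_radj a : tdset G :=
  TDSet (asboolT (star_totally_disconnected (@below_mail_join_closed a))).

Lemma td1_le_radj x a : td1 x <= extend_radj a <-> conn_val (f x) <= a.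
Proof.
rewrite td1_le /= down_star //.
  exact: below_down_closed.
exact: below_mail_join_closed.
Qed.

Lemma extend_galois : galois extend extend_radj.
Proof.
move=> D a; apply/idP/idP => [Da|/td_leP Da].
  apply/td_leP => x Dx; apply/td1_le_radj; apply: le_trans Da.
  by apply: cjoin_ub; exists x.
by apply: cjoin_le => _ [x Dx <-]; apply/td1_le_radj/Da.
Qed.

(** An [x] with [f x] below a separated join has [f x] below one of the
    joinands, because [f x] is connected. *)
Lemma extend_radj_separated : preserves_separated_joins extend_radj.
Proof.
move=> S sepS; apply/le_anti/andP; split; last first.
  apply: cjoin_le => _ [s Ss <-].
  by apply: (galois_homo extend_galois); exact: cjoin_ub.
apply/td_leP => x Dx.
have /td1_le_radj : td1 x <= extend_radj (cjoin S) by exact: td1_le_mem.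
move=> /(@conn_eltP _ _ (f x) _ sepS) [s Ss xs].
apply: (@le_trans _ _ (extend_radj s)); first exact/td1_le_radj.
by apply: cjoin_ub; exists s.
Qed.

Definition extension : conhom (tdset G) L :=
  ConHom (galois_preserves_joins extend_galois)
    (ex_intro2 _ _ extend_radj extend_galois extend_radj_separated).

Lemma extension_td1 x : extension (td1 x) = conn_val (f x).
Proof.
rewrite /= /extend image_set1; apply: cjoin_unique.
by split=> [_ -> //|u]; apply.
Qed.

End Extension.

Lemma conhom_td_ext d (G : chainmailType d) (L : completeLatticeType d)
    (f g : conhom (tdset G) L) : (forall x, f (td1 x) = g (td1 x)) -> f = g.
Proof.
move=> fg; apply: conhom_ext.
by apply: eq_on_singletons fg => S _; exact: conhom_join.
Qed.

(** * Unit, counit and the two functors *)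

Section Unit.
Context {d : Order.disp_t}.
Implicit Types G H : chainmailType d.

Definition unit_fun G (x : G) : conn_elt (tdset G) :=
  ConnElt (asboolT (@td1_connected _ _ x)).

(** The join of the singletons of a mail is the singleton of its join, because
    the down-set of a totally disconnected set is closed under joins of mails. *)
Lemma unit_join G (M : set G) x : mail M -> supremums M x ->
  supremums [set unit_fun y | y in M] (unit_fun x).
Proof.
move=> mM sx; split=> [_ [y My <-]|C ubC].
  suff : td1 y <= td1 x by [].
  by rewrite td1_le_td1; exact: sx.1.
suff : td1 x <= conn_val C by [].
apply/td1_le; apply: (down_mail_join_closed (@tdsetP _ _ _) mM _ sx) => y My.
by apply/td1_le; apply: (ubC (unit_fun y)); exists y.
Qed.

Definition unit_mor G : chmor G (conn_elt (tdset G)) := ChMor (@unit_join G).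

(** A bijective order embedding preserves joins in both directions. *)
Lemma chmor_iso G H (f : chmor G H) : (forall y, exists x, f x = y) ->
  (forall x y, f x <= f y -> x <= y) -> @is_iso (Chm d) G H f.
Proof.
move=> fsurj fle.
have [g gK] := choice fsurj.
have fK x : g (f x) = x by apply/le_anti/andP; split; apply: fle; rewrite gK.
have g_join M y : mail M -> supremums M y -> supremums [set g z | z in M] (g y).
  move=> _ [uby luby]; split=> [_ [z Mz <-]|x ubx].
    by apply: fle; rewrite !gK; exact: uby.
  apply: fle; rewrite gK; apply: luby => z Mz.
  by rewrite -(gK z); apply: chmor_mono; apply: ubx; exists z.
by exists (ChMor g_join); apply: chmor_ext.
Qed.

Lemma unit_iso G : @is_iso (Chm d) G (conn_elt (tdset G)) (unit_mor G).
Proof.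
apply: chmor_iso => [C|x y xy]; last by rewrite -td1_le_td1.
have [x Cx] := connected_td1 (@conn_eltP _ _ C).
by exists x; apply: val_inj; rewrite /= Cx.
Qed.

End Unit.

Section Functors.
Context {d : Order.disp_t}.
Implicit Types (G H : chainmailType d) (L M : completeLatticeType d).

Definition Dmor G H (m : chmor G H) : conhom (tdset G) (tdset H) :=
  extension (chmor_comp (unit_mor H) m).

Lemma Dmor_td1 G H (m : chmor G H) x : Dmor m (td1 x) = td1 (m x).
Proof. exact: extension_td1. Qed.

Definition Kfun L M (F : conhom L M) (c : conn_elt L) : conn_elt M :=
  ConnElt (asboolT (@conhom_connected _ _ _ F _ (@conn_eltP _ _ c))).

Lemma Kfun_join L M (F : conhom L M) (A : set (conn_elt L)) c :
  mail A -> supremums A c -> supremums [set Kfun F a | a in A] (Kfun F c).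
Proof.
move=> mA sc; have e : F (conn_val c) = cjoin [set F (conn_val a) | a in A].
  by rewrite (conn_val_supremum mA sc) conhom_join (image_comp _ F).
split=> [_ [a Aa <-]|b ubb].
  suff : F (conn_val a) <= F (conn_val c) by [].
  by rewrite e; apply: cjoin_ub; exists a.
suff : F (conn_val c) <= conn_val b by [].
rewrite e; apply: cjoin_le => _ [a Aa <-].
by apply: (ubb (Kfun F a)); exists a.
Qed.

Definition Kmor L M (F : conhom L M) : chmor (conn_elt L) (conn_elt M) :=
  ChMor (@Kfun_join L M F).

Definition counit_mor L : conhom (tdset (conn_elt L)) L :=
  extension (chmor_id (conn_elt L)).

Lemma counit_td1 L c : counit_mor L (td1 c) = conn_val c.
Proof. exact: extension_td1. Qed.

(** So every singleton is a value of the right adjoint of the counit, even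
    where the counit is not injective. *)
Lemma counit_radj_conn L c :
  extend_radj (chmor_id (conn_elt L)) (conn_val c) = td1 c.
Proof.
apply: eq_from_lower => D; apply/idP/idP => /td_leP Dc; apply/td_leP => x /Dc.
  by move/td1_le_radj; rewrite td1_le_td1.
by rewrite td1_le_td1 => xc; apply/td1_le_radj.
Qed.

(** The argument passes to the right adjoints of [g] and [h], which are
    determined by their values on singletons. *)
Lemma counit_mono L : @is_mono (Con d) _ _ (counit_mor L).
Proof.
move=> N g h egh.
have eq x : counit_mor L ((g : conhom N _) x) = counit_mor L ((h : conhom N _) x).
  exact: (congr1 (fun k : conhom N L => k x) egh).
have [[g' gg' sg] [h' hh' sh]] := (conhom_adj g, conhom_adj h).
have eg := extend_galois (chmor_id (conn_elt L)).
pose e' := extend_radj (chmor_id (conn_elt L)).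
have gg : galois (counit_mor L \o (g : conhom N _)) (g' \o e').
  by move=> x y; rewrite /= eg gg'.
have hh : galois (counit_mor L \o (g : conhom N _)) (h' \o e').
  by move=> x y; rewrite -hh' -eg; congr (_ <= _); exact: eq.
have gh : g' =1 h'.
  apply: eq_on_singletons => // c; rewrite -counit_radj_conn.
  exact: (galois_radj_unique gg hh).
apply: conhom_ext; apply: galois_ladj_unique gg' _ => x y.
by rewrite gh; exact: hh'.
Qed.

Definition Dfunctor : functor (@Dob d).
Proof.
exists Dmor => [G|G H K]; first by apply: conhom_td_ext => x; exact: Dmor_td1.
move=> /= g f; apply: conhom_td_ext => x.
have e : Dmor g (Dmor f (td1 x)) = td1 (g (f x)) by rewrite !Dmor_td1.
exact: etrans (Dmor_td1 (chmor_comp g f) x) (esym e).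
Defined.

Definition Kfunctor : functor (@Kob d).
Proof.
by exists Kmor => [L|L M N g f]; apply: chmor_ext => c; apply: val_inj.
Defined.

Definition unit_nat : nat_trans (idF (Chm d)) (compF Kfunctor Dfunctor).
Proof.
exists unit_mor => G H m; apply: chmor_ext => x; apply: val_inj.
exact/esym/Dmor_td1.
Defined.

Definition counit_nat : nat_trans (compF Dfunctor Kfunctor) (idF (Con d)).
Proof.
exists counit_mor => L M /= F; apply: conhom_td_ext => c.
have e : F (counit_mor L (td1 c)) = counit_mor M (Dmor (Kmor F) (td1 c)).
  by rewrite Dmor_td1 !counit_td1.
exact: esym e.
Defined.

Lemma unit_counit_adjunction : is_adjunction unit_nat counit_nat.
Proof.
split=> [G|L].
  have e x : counit_mor (tdset G) (Dmor (unit_mor G) (td1 x)) = td1 x.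
    by rewrite Dmor_td1 counit_td1.
  exact: (@conhom_td_ext _ G _ (conhom_comp (counit_mor _) (Dmor (unit_mor G)))
            (conhom_id (tdset G)) e).
apply: chmor_ext => c; apply: val_inj; exact: counit_td1.
Qed.

End Functors.

Theorem theorem28 (d : Order.disp_t) :
  exists (D : functor (@Dob d)) (K : functor (@Kob d))
    (eta : nat_trans (idF (Chm d)) (compF K D))
    (eps : nat_trans (compF D K) (idF (Con d))),
  [/\ forall (G1 G2 : chainmailType d) (m : chmor G1 G2) (D1 : tdset G1),
        (fmor D m : conhom (tdset G1) (tdset G2)) D1
          = cjoin [set td1 (m x) | x in td_set D1],
      forall (G1 G2 : chainmailType d) (m : chmor G1 G2),
        exists2 R : tdset G2 -> tdset G1,
          galois (fmor D m : conhom (tdset G1) (tdset G2)) R &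
          forall D2 : tdset G2,
            td_set (R D2) = star (m @^-1` down (td_set D2)),
      forall (L1 L2 : completeLatticeType d) (F : conhom L1 L2)
          (c : conn_elt L1),
        conn_val ((fmor K F : chmor (conn_elt L1) (conn_elt L2)) c)
          = F (conn_val c),
      is_adjunction eta eps &
      [/\ is_nat_iso eta,
          forall (G : chainmailType d) (x : G),
            conn_val ((eta G : chmor G (conn_elt (tdset G))) x) = td1 x,
          forall (L : completeLatticeType d) (E : tdset (conn_elt L)),
            (eps L : conhom (tdset (conn_elt L)) L) E
              = cjoin [set conn_val c | c in td_set E] &
          forall L : completeLatticeType d, is_mono (eps L)]].
Proof.
exists (@Dfunctor d), (@Kfunctor d), (@unit_nat d), (@counit_nat d); split=> //.
- move=> G1 G2 m; exists (extend_radj (chmor_comp (unit_mor G2) m)).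
    exact: extend_galois.
  move=> D2; congr star.
  by apply/seteqP; split=> x; apply td1_le.
- exact: unit_counit_adjunction.
split=> //.
- exact: unit_iso.
- exact: counit_mono.
Qed.
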